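(* Let $n,k,m$ be integers with $k<n<2k$ and $2\le m\le k$, and let $\mathbf a=a_1\cdots a_n$ be a vertex of $G(n)$ contained in at least one closed $k$-walk. Let $y_{\mathbf a}=y_1\cdots y_{n-1}=\mathrm{st}(a_2\cdots a_n)$ and $z_{\mathbf a}=z_1\cdots z_{n-k+1}=\mathrm{st}(a_1\cdots a_{n-k+1})$. Suppose that either (i) $z_{n-k+1}=1$ and each of $1,\dots,m-1$ occurs among $y_1,\dots,y_{k-1}$, or (ii) $z_{n-k+1}=n-k+1$ and each of $n-m+1,\dots,n-1$ occurs among $y_1,\dots,y_{k-1}$. Then there exist $m$ closed $k$-walks $(\mathbf a,\mathbf b^{(r)},\dots)$, $r=1,\dots,m$, starting at $\mathbf a$ whose second vertices $\mathbf b^{(1)},\dots,\mathbf b^{(m)}$ are pairwise distinct.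
   Context: For a sequence of distinct integers $c_1\cdots c_t$, $\mathrm{st}(c_1\cdots c_t)$ is the unique permutation $d_1\cdots d_t$ of $\{1,\dots,t\}$ with $d_i<d_j$ iff $c_i<c_j$. $G(n)$ is the directed multigraph whose vertices are the permutations of $\{1,\dots,n\}$ (one-line notation) and whose edges are the permutations $c_1\cdots c_{n+1}$ of $\{1,\dots,n+1\}$, the edge $c_1\cdots c_{n+1}$ going from $\mathrm{st}(c_1\cdots c_n)$ to $\mathrm{st}(c_2\cdots c_{n+1})$; so there is an edge from $x_1\cdots x_n$ to $w_1\cdots w_n$ iff $\mathrm{st}(x_2\cdots x_n)=\mathrm{st}(w_1\cdots w_{n-1})$. A closed $k$-walk $(v_1,\dots,v_k)$ is a sequence of vertices with an edge from $v_i$ to $v_{i+1}$ for $i<k$ and from $v_k$ to $v_1$. *)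

(* Defs.v *)
From mathcomp Require Import all_boot all_fingroup.

Set Implicit Arguments.
Unset Strict Implicit.
Unset Printing Implicit Defensive.

(* Words are 0-indexed sequences of naturals: the letter c_i of a word c is
   nth 0 c i.-1.  Permutations are elements of 'S_n, which act on
   {0, ..., n-1}; their one-line words below have letters 1, ..., n. *)

(* The i-th letter of st c is the rank of c_i, counted from 1, among the letters
   of c.  Lemmas st_perm, st_order and st_unique show that, for a word with
   distinct letters, this is the unique order-isomorphic permutation word. *)
Definition st (c : seq nat) : seq nat :=
  [seq count (fun y => y <= x) c | x <- c].

Definition oneline (n : nat) (s : 'S_n) : seq nat :=
  [seq (s i).+1 | i <- enum 'I_n].

Definition edge_joins (n : nat) (c : 'S_n.+1) (u v : 'S_n) : bool :=
  (st (take n (oneline c)) == oneline u)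
  && (st (behead (oneline c)) == oneline v).

Definition adj (n : nat) : rel 'S_n :=
  fun u v => [exists c : 'S_n.+1, edge_joins c u v].

(* path.cycle e [:: v_1; ...; v_k] says e v_i v_(i+1) for i < k and e v_k v_1. *)
Definition closed_walk (n k : nat) (w : seq 'S_n) : bool :=
  (size w == k) && path.cycle (@adj n) w.

Definition y_word (n : nat) (a : 'S_n) : seq nat :=
  st (behead (oneline a)).

Definition z_word (n k : nat) (a : 'S_n) : seq nat :=
  st (take (n - k + 1) (oneline a)).

Lemma size_st c : size (st c) = size c.
Proof. by rewrite size_map. Qed.

Lemma nth_st c i : i < size c ->
  nth 0 (st c) i = count (fun y => y <= nth 0 c i) c.
Proof. by move=> lti; rewrite (nth_map 0). Qed.

Lemma count_lt c x x' : x' \in c -> x < x' ->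
  count (fun y => y <= x) c < count (fun y => y <= x') c.
Proof.
move=> x'c ltx.
have -> : count (fun y => y <= x') c =
    count (fun y => y <= x) c + count (fun y => x < y <= x') c.
  rewrite -count_predUI [X in _ = _ + X](_ : _ = 0).
    rewrite addn0; apply: eq_count => y /=.
    by case: (leqP y x) => //= yx; apply: leq_trans yx (ltnW ltx).
  by apply/eqP; rewrite -leqn0 leqNgt -has_count; apply/hasPn => y _ /=; case: leqP.
by rewrite -[X in X < _]addn0 ltn_add2l -has_count; apply/hasP; exists x'; rewrite ?ltx /=.
Qed.

Lemma st_order c i j : i < size c -> j < size c ->
  (nth 0 (st c) i < nth 0 (st c) j) = (nth 0 c i < nth 0 c j).
Proof.
move=> li lj; rewrite !nth_st //; case: (ltnP (nth 0 c i)) => h.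
  by apply: count_lt; rewrite ?mem_nth.
apply/negbTE; rewrite -leqNgt; apply: sub_count => y /= yi.
exact: leq_trans yi h.
Qed.

Lemma st_perm c : uniq c -> perm_eq (st c) (iota 1 (size c)).
Proof.
move=> Uc.
have Ust : uniq (st c).
  rewrite map_inj_in_uniq // => x x' xc x'c eqxx'.
  case: (ltngtP x x') => // h.
    by have := count_lt x'c h; rewrite eqxx' ltnn.
  by have := count_lt xc h; rewrite eqxx' ltnn.
apply: uniq_perm (iota_uniq _ _) _ => //.
have sub : {subset st c <= iota 1 (size c)}.
  move=> r /mapP[x xc ->]; rewrite mem_iota add1n ltnS count_size andbT.
  by rewrite -has_count; apply/hasP; exists x => /=.
by have [] := uniq_min_size Ust sub; rewrite ?size_iota ?size_st.
Qed.

Lemma st_unique (c d : seq nat) :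
  perm_eq d (iota 1 (size c)) ->
  (forall i j, i < size c -> j < size c ->
     (nth 0 d i < nth 0 d j) = (nth 0 c i < nth 0 c j)) ->
  d = st c.
Proof.
move=> Pd Hd; have sd : size d = size c by rewrite (perm_size Pd) size_iota.
apply: (@eq_from_nth _ 0) => [|i]; rewrite ?size_st // sd => li.
rewrite nth_st //.
have dmem : nth 0 d i \in iota 1 (size c) by rewrite -(perm_mem Pd) mem_nth ?sd.
have -> : nth 0 d i = count (fun y => y <= nth 0 d i) d.
  move: dmem; rewrite (seq.permP Pd) mem_iota add1n ltnS => /andP[_ le].
  set r := nth 0 d i in le *.
  rewrite -(subnKC le) iotaD count_cat.
  rewrite (eq_in_count (a2 := predT)) ?count_predT ?size_iota; last first.
    by move=> y; rewrite mem_iota add1n ltnS => /andP[_ ->].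
  rewrite (eq_in_count (a2 := pred0)) ?count_pred0 ?addn0 ?subnKC //.
  by move=> y; rewrite mem_iota add1n => /andP[lt _] /=; apply/negbTE; rewrite -ltnNge.
have count_nth (P : pred nat) e :
    count P e = count (fun j => P (nth 0 e j)) (iota 0 (size e)).
  by rewrite -[in LHS](mkseq_nth 0 e) /mkseq count_map.
rewrite (count_nth _ d) (count_nth _ c) sd.
apply: eq_in_count => j; rewrite mem_iota /= add0n => lj.
by rewrite [LHS]leqNgt [RHS]leqNgt Hd.
Qed.

Lemma oneline_perm n (s : 'S_n) : perm_eq (oneline s) (iota 1 n).
Proof.
apply: uniq_perm (iota_uniq _ _) _; last move=> r.
  rewrite map_inj_uniq ?enum_uniq // => i j [] /val_inj; exact: perm_inj.
rewrite mem_iota add1n; apply/mapP/andP => [[i _ ->]|[r0 rn]].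
  by split=> //; rewrite ltnS ltn_ord.
case: r r0 rn => // r _; rewrite ltnS => rn.
by exists ((s^-1)%g (Ordinal rn)); rewrite ?mem_enum // permKV.
Qed.

(* Main.v *)
Require Import Defs.
From mathcomp Require Import all_boot all_fingroup.
From mathcomp Require Import zify.

(* A closed k-walk through a is the sequence of length-n windows of a word C of
   n + k distinct letters whose first n and last n letters are both ordered like
   a; as k < n these two blocks overlap.  Prescribing the second vertex amounts
   to prescribing how the letter C_n compares with C_1, ..., C_(n-1), and by
   amalgamation of linear orders the only obstruction is that C_k, ..., C_n must
   be ordered like the first n - k + 1 letters of a.  The hypotheses say that
   C_n must lie below (above) all of C_k, ..., C_(n-1), while the m - 1 smallest
   (largest) letters among C_1, ..., C_(n-1) lie in C_1, ..., C_(k-1): so C_n has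
   m admissible positions. *)

Set Implicit Arguments.
Unset Strict Implicit.
Unset Printing Implicit Defensive.

(** * Standardization and one-line words *)

Lemma eq_st (c d : seq nat) : size c = size d ->
  (forall i j, i < size c -> j < size c ->
     (nth 0 c i < nth 0 c j) = (nth 0 d i < nth 0 d j)) ->
  st c = st d.
Proof.
move=> scd H; apply: (@eq_from_nth _ 0) => [|i]; rewrite ?size_st // => li.
have count_nth (P : pred nat) e :
    count P e = count (fun j => P (nth 0 e j)) (iota 0 (size e)).
  by rewrite -[in LHS](mkseq_nth 0 e) /mkseq count_map.
rewrite !nth_st -?scd // count_nth [RHS]count_nth -scd.
apply: eq_in_count => j; rewrite mem_iota => lj.
by rewrite [LHS]leqNgt [RHS]leqNgt H.
Qed.

Lemma eq_st_mkseq (n : nat) (f g : nat -> nat) :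
  (forall i j, i < n -> j < n -> (f i < f j) = (g i < g j)) ->
  st (mkseq f n) = st (mkseq g n).
Proof.
move=> H; apply: eq_st => [|i j]; rewrite !size_mkseq // => li lj.
by rewrite !nth_mkseq // H.
Qed.

Lemma size_oneline n (s : 'S_n) : size (oneline s) = n.
Proof. by rewrite (perm_size (oneline_perm s)) size_iota. Qed.

Lemma uniq_oneline n (s : 'S_n) : uniq (oneline s).
Proof. by rewrite (perm_uniq (oneline_perm s)) iota_uniq. Qed.

Lemma nth_oneline n (s : 'S_n) i : i < n -> 1 <= nth 0 (oneline s) i <= n.
Proof.
move=> li; have: nth 0 (oneline s) i \in iota 1 n.
  by rewrite -(perm_mem (oneline_perm s)) mem_nth ?size_oneline.
by rewrite mem_iota; lia.
Qed.

Lemma oneline_inj n : injective (@oneline n).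
Proof.
move=> s t /eq_in_map H; apply/permP => i.
by apply/val_inj; have [] := H i (mem_enum _ i).
Qed.

Lemma st_oneline n (s : 'S_n) : st (oneline s) = oneline s.
Proof. by apply/esym/st_unique => //; rewrite size_oneline oneline_perm. Qed.

(** Ranking preserves comparisons, so it may be done before or after cutting out a window. With
    [o = 0] and [o = 1] this identifies the two ends of an edge obtained by ranking a word. *)
Lemma st_idem_mkseq n (f : nat -> nat) (m o : nat) : o + m <= n ->
  st (mkseq (fun i => nth 0 (st (mkseq f n)) (o + i)) m) =
  st (mkseq (fun i => f (o + i)) m).
Proof.
move=> le; apply: eq_st_mkseq => i j li lj.
by rewrite st_order ?size_mkseq ?nth_mkseq //; lia.
Qed.

Lemma perm_of_word n (c : seq nat) : uniq c -> size c = n ->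
  {s : 'S_n | oneline s = st c}.
Proof.
move=> Uc sc; have Pc := st_perm Uc; rewrite sc in Pc.
have Hc i : i < n -> 0 < nth 0 (st c) i <= n.
  move=> li; have: nth 0 (st c) i \in iota 1 n.
    by rewrite -(perm_mem Pc) mem_nth // size_st sc.
  by rewrite mem_iota; lia.
have lt (i : 'I_n) : (nth 0 (st c) i).-1 < n.
  by have := Hc i (ltn_ord i); lia.
have inj : injective (fun i => Ordinal (lt i)).
  have Us : uniq (st c) by rewrite (perm_uniq Pc) iota_uniq.
  move=> i j [] e; apply/ord_inj/(uniqP 0 Us); rewrite ?inE ?size_st ?sc //.
  have /andP[/prednK <- _] := Hc i (ltn_ord i); have /andP[/prednK <- _] := Hc j (ltn_ord j).
  by rewrite e.
exists (perm inj); apply: (@eq_from_nth _ 0) => [|i].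
  by rewrite size_oneline size_st.
rewrite size_oneline => li; rewrite (nth_map (Ordinal li)) ?size_enum_ord //.
by rewrite permE /= nth_enum_ord // prednK //; case/andP: (Hc i li).
Qed.

(** * Edges and closed walks as conditions on the order of letters *)

Lemma adj_window n (f : nat -> nat) (u v : 'S_n) :
  uniq (mkseq f n.+1) -> oneline u = st (mkseq f n) ->
  oneline v = st (mkseq (fun i => f i.+1) n) -> adj u v.
Proof.
move=> Uf eu ev; have [c ec] := perm_of_word Uf (size_mkseq _ _).
apply/existsP; exists c; rewrite /edge_joins ec eu ev.
apply/andP; split; apply/eqP.
- rewrite -(@st_idem_mkseq n.+1 f n 0) //; congr st.
  apply: (@eq_from_nth _ 0) => [|i].
    by rewrite size_take size_st !size_mkseq ltnSn.
  rewrite size_take size_st size_mkseq ltnSn => li.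
  by rewrite nth_take // nth_mkseq.
- rewrite -(@st_idem_mkseq n.+1 f n 1) //; congr st.
  apply: (@eq_from_nth _ 0) => [|i].
    by rewrite size_behead size_st !size_mkseq.
  rewrite size_behead size_st size_mkseq => li.
  by rewrite nth_behead nth_mkseq.
Qed.

Lemma adj_order n (u v : 'S_n) i j : adj u v -> i.+1 < n -> j.+1 < n ->
  (nth 0 (oneline u) i.+1 < nth 0 (oneline u) j.+1) =
  (nth 0 (oneline v) i < nth 0 (oneline v) j).
Proof.
case/existsP => c /andP[/eqP <- /eqP <-] li lj.
have sc := size_oneline c.
rewrite !st_order ?size_takel ?size_behead ?sc //=; try lia.
by rewrite !nth_take ?nth_behead //; lia.
Qed.

(** Each edge shifts positions by one, so a path shifts them by its length. *)
Lemma adj_path_order n (u : 'S_n) p i j : path (@adj n) u p ->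
  size p + i < n -> size p + j < n ->
  (nth 0 (oneline u) (size p + i) < nth 0 (oneline u) (size p + j)) =
  (nth 0 (oneline (last u p)) i < nth 0 (oneline (last u p)) j).
Proof.
elim: p u => //= v p IHp u /andP[uv vp] li lj.
by rewrite !addSn (adj_order uv) ?IHp //; lia.
Qed.

(** Going once around from [a] shifts its word by [k] and returns to [a]. This self-overlap is all
    that the construction uses of the given closed walk. *)
Lemma closed_walk_order n k (w : seq 'S_n) a i j :
  closed_walk k w -> a \in w -> k + i < n -> k + j < n ->
  (nth 0 (oneline a) (k + i) < nth 0 (oneline a) (k + j)) =
  (nth 0 (oneline a) i < nth 0 (oneline a) j).
Proof.
case/andP => /eqP sw cw aw; case: (rot_to aw) => o p ew.
(* The cycle rotated to start at [a] is the path [rcons p a] of [k] edges from [a] to itself. *)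
have sk : size (rcons p a) = k.
  by rewrite size_rcons -sw -(size_rot o w) ew.
have: path.cycle (@adj n) (rot o w) by rewrite rot_cycle.
rewrite ew /=.
by move/(@adj_path_order n a (rcons p a) i j); rewrite sk last_rcons; apply.
Qed.

(** * Building closed walks: amalgamation of linear orders and windows of a word *)

Lemma sub_count_lt (T : eqType) (P Q : pred T) s x : subpred P Q ->
  x \in s -> ~~ P x -> Q x -> count P s < count Q s.
Proof.
move=> sPQ; elim: s => //= y s IHs; rewrite inE => /orP[/eqP <- | xs] nP Qx.
  by rewrite (negbTE nP) Qx; have := sub_count sPQ s; lia.
by have := IHs xs nP Qx; have := sPQ y; case: (P y); case: (Q y); lia.
Qed.

(* Letters are compared first by the number of letters of the overlap that they
   dominate, then left letters come before right ones; an overlap letter is the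
   smallest one in its class. *)
Lemma amalgamation (k l n B : nat) (p q : nat -> nat) :
  k <= l <= k + n ->
  (forall i, i < l -> p i < B) -> (forall i, i < n -> q i < B) ->
  {in gtn l &, injective p} -> {in gtn n &, injective q} ->
  (forall i j, k + i < l -> k + j < l ->
     (p (k + i) < p (k + j)) = (q i < q j)) ->
  exists C : nat -> nat,
  [/\ {in gtn (k + n) &, injective C},
      forall i j, i < l -> j < l -> (C i < C j) = (p i < p j)
    & forall i j, i < n -> j < n -> (C (k + i) < C (k + j)) = (q i < q j)].
Proof.
move=> kl Bp Bq Ip Iq H.
pose o := iota 0 (l - k).
pose cL x := count (fun j => p (k + j) <= x) o.
pose cR x := count (fun j => q j <= x) o.
have cL_mono x y : x <= y -> cL x <= cL y.
  by move=> xy; apply: sub_count => j /= h; apply: leq_trans xy.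
have cR_mono x y : x <= y -> cR x <= cR y.
  by move=> xy; apply: sub_count => j /= h; apply: leq_trans xy.
(* Since [p] and [q] agree on the overlap, an overlap letter gets the same class from either
   side. *)
have cLR i : k + i < l -> cL (p (k + i)) = cR (q i).
  move=> li; apply: eq_in_count => j; rewrite mem_iota => lj.
  by rewrite leqNgt H ?[RHS]leqNgt //; lia.
have cR_lt i x : k + i < l -> x < q i -> cR x < cR (q i).
  move=> li xq; apply: (@sub_count_lt _ _ _ _ i) => //=.
  - by move=> j /= h; apply: leq_trans (ltnW xq).
  - by rewrite mem_iota; lia.
  - by rewrite -ltnNge.
(* The lexicographic order written in base [2 * B]: the class is the leading digit, and the trailing
   digit is below [B] for left letters and at least [B] for the others, so the two kinds never
   collide. *)
pose C i := if i < l then cL (p i) * (2 * B) + p i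
            else cR (q (i - k)) * (2 * B) + B + q (i - k).
have step x y a b : x < y -> a < 2 * B -> x * (2 * B) + a < y * (2 * B) + b.
  move=> xy aB; have : x.+1 * (2 * B) <= y * (2 * B) by rewrite leq_mul2r xy orbT.
  by rewrite mulSn; lia.
have CL i j : i < l -> j < l -> (C i < C j) = (p i < p j).
  move=> li lj; rewrite /C li lj.
  have mono x y : x <= y -> cL x * (2 * B) + x <= cL y * (2 * B) + y.
    by move=> xy; apply: leq_add; rewrite // leq_mul2r cL_mono // orbT.
  have [pij|pji] := ltnP (p i) (p j); last by have := mono _ _ pji; lia.
  have : cL (p i) * (2 * B) <= cL (p j) * (2 * B) by rewrite leq_mul2r cL_mono ?orbT // ltnW.
  by lia.
have CR i j : i < n -> j < n -> q i < q j -> C (k + i) < C (k + j).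
  move=> li lj qij; have := Bq i li; have := Bq j lj => Bj Bi.
  have [lki|lki] := boolP (k + i < l); have [lkj|lkj] := boolP (k + j < l).
  - by rewrite CL // H.
  - rewrite /C lki (negbTE lkj) cLR // addKn.
    have : cR (q i) * (2 * B) <= cR (q j) * (2 * B) by rewrite leq_mul2r cR_mono ?orbT // ltnW.
    by have := Bp _ lki; lia.
  (* A right letter below an overlap letter lies in a strictly lower class, because the overlap
     letter counts itself. *)
  - rewrite /C lkj (negbTE lki) cLR // addKn -addnA.
    by apply: step; [apply: cR_lt | lia].
  - rewrite /C (negbTE lki) (negbTE lkj) !addKn.
    have : cR (q i) * (2 * B) <= cR (q j) * (2 * B) by rewrite leq_mul2r cR_mono ?orbT // ltnW.
    by lia.
have eqP2 i j : i < n -> j < n -> C (k + i) = C (k + j) -> i = j.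
  move=> li lj e; apply: Iq => //.
  case: (ltngtP (q i) (q j)) => // h; first by have := CR _ _ li lj h; rewrite e ltnn.
  by have := CR _ _ lj li h; rewrite e ltnn.
have C_neq i j : i < l -> ~~ (j < l) -> j < k + n -> C i <> C j.
  move=> li lj ljn; rewrite /C li (negbTE lj) -addnA => e.
  have Bi := Bp _ li; have Bj : q (j - k) < B by apply: Bq; lia.
  have [h|h|h] := ltngtP (cL (p i)) (cR (q (j - k))).
  - by have := @step _ _ (p i) (B + q (j - k)) h; lia.
  - by have := @step _ _ (B + q (j - k)) (p i) h; lia.
  - by rewrite h in e; lia.
exists C; split=> //.
- move=> i j; rewrite !inE => li lj e.
  have [lil|lil] := boolP (i < l); have [ljl|ljl] := boolP (j < l).
  + apply: Ip; rewrite ?inE //.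
    case: (ltngtP (p i) (p j)) => // h; first by have := CL _ _ lil ljl; rewrite h e ltnn.
    by have := CL _ _ ljl lil; rewrite h e ltnn.
  + by case: (C_neq _ _ lil ljl lj).
  + by case: (C_neq _ _ ljl lil li).
  + have ki : k <= i by lia.
    have kj : k <= j by lia.
    rewrite -(subnKC ki) -(subnKC kj) in e *.
    by congr (_ + _); apply: eqP2 e; lia.
- move=> i j li lj; have [|qji] := ltnP (q i) (q j); first exact: CR.
  have [/CR h|h] : q j < q i \/ q j = q i by lia.
    by have := h lj li; lia.
  by rewrite (Iq _ _ _ _ h) ?inE ?ltnn.
Qed.

(** Injectivity of [C] makes any two consecutive windows adjacent, and the walk closes because the
    windows at offsets [0] and [k] both standardize to [a]. *)
Lemma closed_walk_windows n k (C : nat -> nat) (a b : 'S_n) :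
  1 < k -> {in gtn (k + n) &, injective C} ->
  oneline a = st (mkseq C n) -> oneline a = st (mkseq (fun i => C (k + i)) n) ->
  oneline b = st (mkseq (fun i => C i.+1) n) ->
  exists w : seq 'S_n, [/\ closed_walk k w, nth a w 0 = a & nth a w 1 = b].
Proof.
move=> k1 IC ea0 eak eb.
have Uw i N : i + N <= k + n -> uniq (mkseq (fun j => C (i + j)) N).
  move=> le; apply/(uniqP 0) => x y; rewrite !inE size_mkseq => lx ly.
  by rewrite !nth_mkseq // => /IC; rewrite !inE => e; apply: (@addnI i); apply: e; lia.
have [v Hv] : exists v : nat -> 'S_n, forall i, i <= k ->
    oneline (v i) = st (mkseq (fun j => C (i + j)) n).
  have ex (i : 'I_k.+1) : exists s : 'S_n, oneline s = st (mkseq (fun j => C (i + j)) n).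
    have [|s es] := perm_of_word (Uw i n _) (size_mkseq _ _); last by exists s.
    by have := ltn_ord i; lia.
  have [f Hf] := fin_all_exists ex.
  by exists (fun i => f (inord i)) => i li; rewrite Hf inordK.
have v0 : v 0 = a by apply: oneline_inj; rewrite Hv.
have vk : v k = a by apply: oneline_inj; rewrite Hv.
have v1 : v 1 = b by apply: oneline_inj; rewrite Hv ?eb // ltnW.
have adjv i : i < k -> adj (v i) (v i.+1).
  move=> li; apply: (@adj_window n (fun j => C (i + j))); rewrite ?Hv //; try lia.
    by apply: Uw; lia.
  by congr st; apply: eq_mkseq => j; rewrite addSnnS.
exists (mkseq v k); split; last 2 first.
- by rewrite nth_mkseq //; lia.
- by rewrite nth_mkseq.
rewrite /closed_walk size_mkseq eqxx /=.
case: k k1 {IC ea0 eak Uw Hv v1} vk adjv => // k' _ vk adjv.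
have -> : mkseq v k'.+1 = v 0 :: mkseq (fun i => v i.+1) k'.
  by rewrite /mkseq /= -[1]addn0 iotaDl -map_comp.
(* The closing vertex is read as [v k], which turns the cycle into the path from [v 0] to [v k]. *)
rewrite /= v0 -{2}vk -(mkseqS (fun i => v i.+1)) -v0.
apply/(pathP a) => i; rewrite size_mkseq => li.
by rewrite nth_mkseq //; case: i li => [|i] li; rewrite /= ?nth_mkseq ?adjv // ltnW.
Qed.

(** * Inserting the letter C_n at a prescribed rank *)

Lemma count_leq_iota t N : count (fun y => y <= t) (iota 1 N) = minn t N.
Proof.
elim: N => [|N IHN]; first by rewrite minn0.
by rewrite -[N.+1]addn1 iotaD count_cat IHN /=; lia.
Qed.

Lemma size_y_word n (a : 'S_n) : size (y_word a) = n.-1.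
Proof. by rewrite size_st size_behead size_oneline. Qed.

Lemma y_word_perm n (a : 'S_n) : perm_eq (y_word a) (iota 1 n.-1).
Proof.
rewrite -{2}(size_oneline a) -size_behead; apply: st_perm.
by have := uniq_oneline a; case: (oneline a) => //= x s /andP[].
Qed.

(** Turns a cut among the ranks in [y_word a] into a cut among the letters of [a]: [x] is the letter
    of rank [t], found one position later in [a] since [y_word] drops the first letter, or [0] when
    [t = 0]. *)
Lemma y_word_threshold n (a : 'S_n) t : t < n ->
  exists2 x, x <= n & forall i, i < n.-1 ->
    (nth 0 (oneline a) i.+1 <= x) = (nth 0 (y_word a) i <= t).
Proof.
move=> tn; case: (posnP t) => [->|t0].
  exists 0 => // i li; have /andP[h _] := @nth_oneline n a i.+1 ltac:(lia).
  have : nth 0 (y_word a) i \in iota 1 n.-1.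
    by rewrite -(perm_mem (y_word_perm a)) mem_nth ?size_y_word.
  by rewrite mem_iota; lia.
have ty : t \in y_word a by rewrite (perm_mem (y_word_perm a)) mem_iota; lia.
have lty : index t (y_word a) < n.-1 by rewrite -(size_y_word a) index_mem.
exists (nth 0 (oneline a) (index t (y_word a)).+1) => [|i li].
  by have /andP[] := @nth_oneline n a (index t (y_word a)).+1 ltac:(lia).
rewrite -[in RHS](nth_index 0 ty) [RHS]leqNgt st_order ?size_behead ?size_oneline //.
by rewrite !nth_behead leqNgt.
Qed.

(* The last letter t + 1 of the second vertex means that C_n is larger than
   exactly t of C_1, ..., C_(n-1). *)
Lemma closed_walk_insert n k (a : 'S_n) t : 1 < k < n -> t < n ->
  (forall i j, k + i < n -> k + j < n ->
    (nth 0 (oneline a) (k + i) < nth 0 (oneline a) (k + j)) =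
    (nth 0 (oneline a) i < nth 0 (oneline a) j)) ->
  (forall i, k + i < n -> (nth 0 (y_word a) (k + i).-1 <= t) =
    (nth 0 (oneline a) i < nth 0 (oneline a) (n - k))) ->
  exists w : seq 'S_n, [/\ closed_walk k w, nth a w 0 = a &
    nth 0 (oneline (nth a w 1)) n.-1 = t.+1].
Proof.
case/andP => k1 kn tn Hov Ht.
set A := nth 0 (oneline a) in Hov Ht *; set Y := nth 0 (y_word a) in Ht.
have [x xn] := y_word_threshold a tn; rewrite -/A -/Y => Hx.
have A_inj : {in gtn n &, injective A}.
  move=> i j; rewrite !inE => li lj /(uniqP 0 (uniq_oneline a)).
  by rewrite !inE size_oneline; apply.
have A_bound i : i < n -> A i <= n by move=> /(nth_oneline a)/andP[].
have eA : mkseq A n = oneline a by rewrite -{1}(size_oneline a) mkseq_nth.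
(* Doubling the letters of [a] leaves room for the new letter, at index [n], strictly between those
   at most [x] and those above [x]. *)
pose p i := if i < n then (A i).*2 else x.*2.+1.
have pn : p n = x.*2.+1 by rewrite /p ltnn.
have pA i : i < n -> p i = (A i).*2 by rewrite /p => ->.
have p_inj : {in gtn n.+1 &, injective p}.
  move=> i j; rewrite !inE => li lj; rewrite /p.
  case: ifP => hi; case: ifP => hj e; try lia.
  by apply: A_inj => //; lia.
(* Compatibility on the overlap: [Hov] settles the old letters, and [Ht] the comparisons with the
   new one. *)
have p_ov i j : k + i < n.+1 -> k + j < n.+1 ->
    (p (k + i) < p (k + j)) = (A i < A j).
  have xA l : k + l < n -> (p (k + l) < p n) = (A l < A (n - k)).
    move=> ll; rewrite pn pA // -Ht // ltnS leq_double -Hx; last by lia.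
    by rewrite prednK //; lia.
  move=> li lj.
  have [ki|ki] := ltnP (k + i) n; have [kj|kj] := ltnP (k + j) n.
  - by rewrite !pA // ltn_double Hov.
  - have [-> ->] : k + j = n /\ j = n - k by lia.
    exact: xA.
  - have [-> ->] : k + i = n /\ i = n - k by lia.
    have := xA j kj; have := @A_inj j (n - k); rewrite !inE pn pA //.
    move=> Aj; have : A j <> A (n - k) by move/Aj; lia.
    by lia.
  - have -> : i = j by lia.
    by rewrite !ltnn.
have [C [C_inj Cp CA]] : exists C : nat -> nat,
    [/\ {in gtn (k + n) &, injective C},
      forall i j, i < n.+1 -> j < n.+1 -> (C i < C j) = (p i < p j)
    & forall i j, i < n -> j < n -> (C (k + i) < C (k + j)) = (A i < A j)].
  apply: (@amalgamation k n.+1 n (n.*2.+2)) => //; first by lia.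
  - by move=> i _; rewrite /p; case: ifP => [/A_bound|_]; lia.
  - by move=> i /A_bound; lia.
have Up : uniq (mkseq (fun i => p i.+1) n).
  apply/(uniqP 0) => i j; rewrite !inE size_mkseq => li lj.
  by rewrite !nth_mkseq // => /p_inj e; apply: succn_inj; apply: e; rewrite inE.
have [b eb] := perm_of_word Up (size_mkseq _ _).
have [|||||w [w_closed w0 w1]] := @closed_walk_windows n k C a b => //.
- rewrite -st_oneline -eA; apply: eq_st_mkseq => i j li lj.
  by rewrite Cp ?pA ?ltn_double //; lia.
- by rewrite -st_oneline -eA; apply: eq_st_mkseq => i j li lj; rewrite CA.
- by rewrite eb; apply: eq_st_mkseq => i j li lj; rewrite Cp.
exists w; split=> //; rewrite w1 eb nth_st ?size_mkseq; last by lia.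
rewrite nth_mkseq; last by lia.
have n0 : 0 < n by lia.
(* The new letter counts itself, which gives the successor. The other letters below it are those
   whose rank in [y_word a] is at most [t], and there are [t] of them. *)
rewrite -[in mkseq _ _](prednK n0) mkseqS -cats1 count_cat /= prednK // leqnn.
rewrite !addn0 addn1; congr _.+1.
have -> : count (fun y => y <= p n) (mkseq (fun i => p i.+1) n.-1) =
          count (fun y => y <= t) (mkseq Y n.-1).
  rewrite !count_map; apply: eq_in_count => i; rewrite mem_iota => /= li.
  by rewrite -Hx // pn pA; lia.
rewrite -(size_y_word a) mkseq_nth (seq.permP (y_word_perm a)) count_leq_iota.
by lia.
Qed.

(** * The m admissible ranks *)

Theorem theorem3p8 (n k m : nat) (a : 'S_n)
  (hkn : k < n < 2 * k) (hm : 2 <= m <= k)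
  (ha : exists2 w : seq 'S_n, closed_walk k w & a \in w)
  (hyz :
    (nth 0 (z_word k a) (n - k) = 1
     /\ forall j, 1 <= j <= m - 1 -> j \in take (k - 1) (y_word a))
    \/
    (nth 0 (z_word k a) (n - k) = n - k + 1
     /\ forall j, n - m + 1 <= j <= n - 1 -> j \in take (k - 1) (y_word a))) :
  exists W : 'I_m -> seq 'S_n,
    (forall r, closed_walk k (W r) /\ nth a (W r) 0 = a)
    /\ injective (fun r => nth a (W r) 1).
Proof.
have [w w_closed aw] := ha.
have Hov i j := @closed_walk_order n k w a i j w_closed aw.
(* It suffices to find [m] admissible ranks: distinct ranks give second vertices with distinct last
   letters. *)
suff [T T_inj HT] : exists2 T : 'I_m -> nat, injective T & forall r, T r < n /\
    forall i, k + i < n -> (nth 0 (y_word a) (k + i).-1 <= T r) =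
      (nth 0 (oneline a) i < nth 0 (oneline a) (n - k)).
  have ex r : exists w : seq 'S_n, [/\ closed_walk k w, nth a w 0 = a &
      nth 0 (oneline (nth a w 1)) n.-1 = (T r).+1].
    by have [Tn HTr] := HT r; apply: closed_walk_insert => //; lia.
  have [W HW] := fin_all_exists ex.
  exists W; split=> [r|r s ers]; first by have [] := HW r.
  apply: T_inj; have [_ _ er] := HW r; have [_ _ es] := HW s.
  by apply: succn_inj; rewrite -er -es ers.
have Y_range i : i < n.-1 -> 1 <= nth 0 (y_word a) i <= n.-1.
  move=> li; have : nth 0 (y_word a) i \in iota 1 n.-1.
    by rewrite -(perm_mem (y_word_perm a)) mem_nth ?size_y_word.
  by rewrite mem_iota; lia.
(* Position [(k + i).-1] lies beyond the first [k - 1], and the letters of [y_word a] are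
   distinct. *)
have Y_notin i : k + i < n -> nth 0 (y_word a) (k + i).-1 \notin take (k - 1) (y_word a).
  move=> li; have Uy : uniq (y_word a) by rewrite (perm_uniq (y_word_perm a)) iota_uniq.
  have lt : (k + i).-1 < size (y_word a) by rewrite size_y_word; lia.
  rewrite in_take ?mem_nth // index_uniq // -leqNgt; lia.
have size_z : size (take (n - k + 1) (oneline a)) = n - k + 1.
  by rewrite size_takel ?size_oneline //; lia.
have z_perm : perm_eq (z_word k a) (iota 1 (n - k + 1)).
  by rewrite -[in iota 1 _]size_z; apply: st_perm; rewrite take_uniq ?uniq_oneline.
have z_uniq : uniq (z_word k a) by rewrite (perm_uniq z_perm) iota_uniq.
have z_order i : k + i < n ->
    (nth 0 (oneline a) i < nth 0 (oneline a) (n - k)) =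
    (nth 0 (z_word k a) i < nth 0 (z_word k a) (n - k)).
  by move=> li; rewrite st_order ?size_z ?nth_take //; lia.
have z_range i : k + i < n -> 1 <= nth 0 (z_word k a) i <= n - k + 1.
  move=> li; have : nth 0 (z_word k a) i \in iota 1 (n - k + 1).
    by rewrite -(perm_mem z_perm) mem_nth // size_st size_z; lia.
  by rewrite mem_iota; lia.
have z_neq i : k + i < n -> nth 0 (z_word k a) i <> nth 0 (z_word k a) (n - k).
  move=> li /(uniqP 0 z_uniq); rewrite !inE size_st size_z => h.
  by have := h ltac:(lia) ltac:(lia); lia.
case: hyz => -[zE yE].
(* In case (i) no overlap letter may lie below C_n. Their ranks avoid 1, ..., m-1, so they are at
   least m and exceed each of the thresholds 0, ..., m-1. *)
- exists (@nat_of_ord m) => [|r]; first exact: ord_inj.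
  split=> [|i li]; first by have := ltn_ord r; lia.
  rewrite z_order // zE; have := z_range i li; have := Y_range (k + i).-1 ltac:(lia).
  have := ltn_ord r; have := Y_notin i li.
  have := yE (nth 0 (y_word a) (k + i).-1).
  by case: (_ \in _) => // h _; have := contra_not h; lia.
(* In case (ii) all of C_k, ..., C_(n-1) must lie below C_n. Their ranks are at most n-m, so the
   thresholds n-m, ..., n-1 all work. *)
- exists (fun r : 'I_m => n - 1 - r) => [r s|r].
    by move=> e; apply: ord_inj; have := ltn_ord r; have := ltn_ord s; lia.
  split=> [|i li]; first by lia.
  rewrite z_order //; have := z_neq i li; rewrite zE.
  have := z_range i li; have := Y_range (k + i).-1 ltac:(lia).
  have := ltn_ord r; have := Y_notin i li.
  have := yE (nth 0 (y_word a) (k + i).-1).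
  by case: (_ \in _) => // h _; lia.
Qed.
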